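(* Let $q$ be a complex number with $|q|<1$, and let $a,b,c$ be complex numbers with $|a|<1$, $|b|<1$ and $|c|\le 1$. Then \[ \sum_{n=1}^{\infty}\frac{(b/a;q)_n\,a^n}{(1-cq^n)(b;q)_n}=\sum_{m=0}^{\infty}\frac{(b/c;q)_m\,c^m}{(b;q)_m}\left(\frac{aq^m}{1-aq^m}-\frac{bq^m}{1-bq^m}\right). \] If, in addition, $|b|<|c|$, then \[ \sum_{n=1}^{\infty}\frac{(b/a;q)_n\,a^n}{(1-cq^n)(b;q)_n}=\frac{(b/c;q)_\infty}{(b;q)_\infty}\sum_{n=0}^{\infty}\frac{(c;q)_n\,(b/c)^n}{(q;q)_n}\sum_{m=1}^{\infty}\frac{a^m-b^m}{1-cq^{m+n}}. \]
   Context: For complex $A$ and $|q|<1$: $(A;q)_0=1$, $(A;q)_n=(1-A)(1-Aq)\cdots(1-Aq^{n-1})$ for $n\ge1$, and $(A;q)_\infty=\lim_{n\to\infty}(A;q)_n$. *)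

(* Defs.v *)
From Stdlib Require Import Reals.
From Coquelicot Require Import Coquelicot.

Open Scope C_scope.

(** [(A;q)_n] *)
Fixpoint qpoch (A q : C) (n : nat) : C :=
  match n with
  | O => 1
  | S k => qpoch A q k * (1 - A * q ^ k)
  end.

Definition is_Clim_seq (u : nat -> C) (l : C) : Prop :=
  filterlim u eventually (locally l).

Definition ex_Clim_seq (u : nat -> C) : Prop :=
  exists l : C, is_Clim_seq u l.

(** Total limit and sum operators, meaningful only for convergent arguments. *)
Definition Clim_seq (u : nat -> C) : C :=
  (real (Lim_seq (fun n => fst (u n))), real (Lim_seq (fun n => snd (u n)))).

Definition CSeries (u : nat -> C) : C := Clim_seq (sum_n u).

Lemma is_Clim_seq_unique (u : nat -> C) (l : C) :
  is_Clim_seq u l -> Clim_seq u = l.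
Proof.
  intros H; destruct l as [x y]; unfold Clim_seq.
  rewrite (is_lim_seq_unique (fun n => fst (u n)) x).
  - rewrite (is_lim_seq_unique (fun n => snd (u n)) y); [reflexivity|].
    apply (filterlim_comp _ _ _ u snd _ _ _ H).
    intros P [e He]; exists e; intros z [_ Hz]; exact (He _ Hz).
  - apply (filterlim_comp _ _ _ u fst _ _ _ H).
    intros P [e He]; exists e; intros z [Hz _]; exact (He _ Hz).
Qed.

Lemma is_CSeries_unique (u : nat -> C) (l : C) :
  is_series u l -> CSeries u = l.
Proof. exact (is_Clim_seq_unique (sum_n u) l). Qed.

(** [(A;q)_infinity] *)
Definition qpoch_inf (A q : C) : C := Clim_seq (qpoch A q).

(** [(b/a;q)_n a^n = (a - b) (a - b q) ... (a - b q^(n-1))]; at [a = 0], where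
    [b/a] is not defined, the expression denotes its limit as [a -> 0], that is
    [(-b) (-b q) ... (-b q^(n-1)) = (-b)^n q^(n(n-1)/2)]. *)
Definition qpoch_div_pow (b a q : C) (n : nat) : C :=
  if Ceq_dec a 0 then (- b) ^ n * q ^ (n * (n - 1) / 2)
  else qpoch (b / a) q n * a ^ n.

(* Main.v *)
(** Write [P_n(a)] for [(a - b) (a - b q) ... (a - b q^(n-1))] and put
    [E_N = sum_(n >= 1) P_n(a) q^(n N) / ((1 - c q^n) (b;q)_(n+N))], so that [E_0] is
    the left-hand side.  In [E_N - (c - b q^N) E_(N+1)] the factor [1 - c q^n] cancels
    and the remaining sum telescopes, so that [P_N(c) E_N - P_(N+1)(c) E_(N+1)] is the
    [N]-th term of the first right-hand side; as [P_N(c) E_N -> 0], the first identity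
    follows.  For the second one, expand each inner sum as
    [sum_m c^m q^(m n) (a q^m / (1 - a q^m) - b q^m / (1 - b q^m))], exchange the two
    summations and evaluate the sums over [n] by the q-binomial theorem. *)
Require Import Defs.
From Stdlib Require Import Reals Lra Lia.
From Coquelicot Require Import Coquelicot.
Open Scope C_scope.

(** * Complex limits and series *)

Lemma Cmod_one_minus_ge (x : C) : (1 - Cmod x <= Cmod (1 - x))%R.
Proof.
  assert (H := Cmod_triangle (1 - x) x).
  replace (1 - x + x) with (RtoC 1) in H by ring.
  rewrite Cmod_1 in H; lra.
Qed.

Lemma one_minus_neq_0 (x : C) : (Cmod x < 1)%R -> 1 - x <> 0.
Proof.
  intros Hx H; assert (H' := Cmod_one_minus_ge x).
  rewrite H, Cmod_0 in H'; lra.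
Qed.

Lemma pow_le_1 (x : R) (n : nat) : (0 <= x <= 1)%R -> (0 <= x ^ n <= 1)%R.
Proof.
  intros Hx; split; [now apply pow_le|].
  rewrite <- (pow1 n); now apply pow_incr.
Qed.

Lemma Cmod_pow_le_1 (x : C) (n : nat) : (Cmod x <= 1)%R -> (Cmod (x ^ n) <= 1)%R.
Proof.
  intros Hx; rewrite Cmod_pow; apply pow_le_1; split; [apply Cmod_ge_0|exact Hx].
Qed.

Lemma Cmod_mult_le (x y : C) (A B : R) :
  (Cmod x <= A)%R -> (Cmod y <= B)%R -> (Cmod (x * y) <= A * B)%R.
Proof.
  intros Hx Hy; rewrite Cmod_mult.
  apply Rmult_le_compat; auto using Cmod_ge_0.
Qed.

Lemma Cmod_mult_lt_1 (x y : C) :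
  (Cmod x < 1)%R -> (Cmod y <= 1)%R -> (Cmod (x * y) < 1)%R.
Proof.
  intros Hx Hy; rewrite Cmod_mult.
  assert (H := Cmod_ge_0 x); assert (H' := Cmod_ge_0 y); nra.
Qed.

Lemma Cmod_inv_one_minus_le (x : C) (r : R) :
  (Cmod x <= r < 1)%R -> (Cmod (/ (1 - x)) <= / (1 - r))%R.
Proof.
  intros [Hx Hr]; rewrite Cmod_inv by (apply one_minus_neq_0; lra).
  apply Rinv_le_contravar; [lra|].
  assert (H := Cmod_one_minus_ge x); lra.
Qed.

Lemma is_Clim_seq_geom (u : nat -> C) (l : C) (K r : R) :
  (0 <= r < 1)%R -> (forall n, Cmod (u n - l) <= K * r ^ n)%R ->
  is_Clim_seq u l.
Proof.
  intros Hr Hu; unfold is_Clim_seq.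
  apply filterlim_locally; intros eps.
  assert (Hlim : is_lim_seq (fun n => K * r ^ n)%R 0).
  { replace (Finite 0) with (Rbar_mult K 0) by (simpl; now rewrite Rmult_0_r).
    apply is_lim_seq_scal_l, is_lim_seq_geom.
    rewrite Rabs_pos_eq; lra. }
  apply is_lim_seq_spec in Hlim.
  generalize (Hlim eps); apply filter_imp; intros n Hn.
  apply C_NormedModule_mixin_compat1.
  eapply Rle_lt_trans; [exact (Hu n)|].
  rewrite Rminus_0_r in Hn; eapply Rle_lt_trans; [apply Rle_abs|exact Hn].
Qed.

Lemma is_Clim_seq_inj (u : nat -> C) (l l' : C) :
  is_Clim_seq u l -> is_Clim_seq u l' -> l = l'.
Proof.
  intros H H'; rewrite <- (is_Clim_seq_unique _ _ H); now apply is_Clim_seq_unique.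
Qed.

Lemma is_Clim_seq_ext (u v : nat -> C) (l : C) :
  (forall n, u n = v n) -> is_Clim_seq u l -> is_Clim_seq v l.
Proof. intros H; apply filterlim_ext; exact H. Qed.

Lemma is_Clim_seq_scal (u : nat -> C) (k l : C) :
  is_Clim_seq u l -> is_Clim_seq (fun n => k * u n) (k * l).
Proof.
  intros H; apply (filterlim_comp _ _ _ u (Cmult k) _ _ _ H).
  exact (filterlim_scal_r (V := C_NormedModule) k l).
Qed.

Lemma is_Clim_seq_minus (u v : nat -> C) (l l' : C) :
  is_Clim_seq u l -> is_Clim_seq v l' -> is_Clim_seq (fun n => u n - v n) (l - l').
Proof.
  intros H H'; unfold is_Clim_seq.
  eapply (filterlim_comp_2 u (fun n => - v n) Cplus).
  - exact H.
  - exact (filterlim_comp _ _ _ _ _ _ _ _ H' (filterlim_opp (V := C_NormedModule) l')).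
  - exact (filterlim_plus (V := C_NormedModule) l (- l')).
Qed.

Lemma Cmod_is_Clim_seq (u : nat -> C) (l : C) :
  is_Clim_seq u l -> is_lim_seq (fun n => Cmod (u n)) (Cmod l).
Proof.
  intros H; apply (filterlim_comp _ _ _ u Cmod _ _ _ H).
  exact (filterlim_norm (V := C_NormedModule) l).
Qed.

(** Comparison with a geometric series. The bound on the sum is kept along with convergence: it
    controls tails in [is_series_swap] and the decay of E_N in [N]. *)
Lemma CSeries_geom_bound (u : nat -> C) (K r : R) :
  (0 <= r < 1)%R -> (forall n, Cmod (u n) <= K * r ^ n)%R ->
  is_series u (CSeries u) /\ (Cmod (CSeries u) <= K / (1 - r))%R.
Proof.
  intros Hr Hu.
  assert (Hg : is_series (fun n => K * r ^ n)%R (K / (1 - r))%R).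
  { apply (is_series_scal K (fun n => r ^ n)%R).
    apply is_series_geom; rewrite Rabs_pos_eq; lra. }
  destruct (ex_series_le (V := C_CompleteNormedModule) u _ Hu (ex_intro _ _ Hg)) as [l Hl].
  change (is_series (V := C_NormedModule) u l) in Hl.
  rewrite (is_CSeries_unique _ _ Hl); split; [exact Hl|].
  apply (is_lim_seq_le (fun n => Cmod (sum_n u n)) (sum_n (fun n => K * r ^ n)%R)
           (Cmod l) (K / (1 - r))%R).
  - intros n; eapply Rle_trans;
      [exact (norm_sum_n_m (V := C_NormedModule) u 0 n)|].
    now apply sum_n_m_le.
  - now apply Cmod_is_Clim_seq.
  - exact Hg.
Qed.

(* Coquelicot's combinators produce equations and operations on the carriers of
   its structures, which [ring] and [field] do not recognise as [C]. *)
Lemma is_series_ext_C (u v : nat -> C) (l : C) :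
  (forall n, u n = v n) -> is_series u l -> is_series v l.
Proof. exact (is_series_ext u v l). Qed.

Lemma is_series_minus_C (u v : nat -> C) (l l' : C) :
  is_series u l -> is_series v l' -> is_series (fun n => u n - v n) (l - l').
Proof. exact (is_series_minus u v l l'). Qed.

Lemma is_series_scal_C (u : nat -> C) (k l : C) :
  is_series u l -> is_series (fun n => k * u n) (k * l).
Proof. exact (is_series_scal k u l). Qed.

Lemma is_series_unique_C (u : nat -> C) (l l' : C) :
  is_series u l -> is_series u l' -> l = l'.
Proof. exact (is_Clim_seq_inj (sum_n u) l l'). Qed.

Lemma is_series_telescope (u : nat -> C) (l : C) :
  is_Clim_seq u l -> is_series (fun n => u n - u (S n)) (u 0%nat - l).
Proof.
  intros H; unfold is_series.
  apply (filterlim_ext (fun n => u 0%nat - u (S n))).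
  - induction x as [|n IH].
    + now rewrite sum_O.
    + rewrite sum_Sn, <- IH.
      change (u 0%nat - u (S (S n)) = u 0%nat - u (S n) + (u (S n) - u (S (S n)))); ring.
  - assert (H1 : is_Clim_seq (fun n => u (S n)) l).
    { apply (filterlim_comp _ _ _ S u _ eventually); [|exact H].
      apply eventually_subseq; intros n; lia. }
    apply is_Clim_seq_minus; [apply filterlim_const|exact H1].
Qed.

Lemma is_series_geom_C (x : C) : (Cmod x < 1)%R -> is_series (fun n => x ^ n) (/ (1 - x)).
Proof.
  intros Hx; assert (H1 := one_minus_neq_0 x Hx).
  replace (/ (1 - x)) with (x ^ 0 / (1 - x) - 0) by (simpl; field; exact H1).
  apply (is_series_ext_C (fun n => x ^ n / (1 - x) - x ^ S n / (1 - x))).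
  - intros n; rewrite Cpow_S; field; exact H1.
  - apply (is_series_telescope (fun n => x ^ n / (1 - x))).
    apply (is_Clim_seq_geom _ _ (Cmod (/ (1 - x))) (Cmod x));
      [split; [apply Cmod_ge_0|exact Hx]|].
    intros n; rewrite <- Cmod_pow, <- Cmod_mult; apply Req_le; f_equal.
    unfold Cdiv; ring.
Qed.

(** Fubini under geometric domination. The sum of [h] minus the [N]-th partial sum of [g] is the
    series over [m] of the column tails beyond row [N], hence of order r^N. *)
Lemma is_series_swap (f : nat -> nat -> C) (g h : nat -> C) (K r s : R) :
  (0 <= r < 1)%R -> (0 <= s < 1)%R ->
  (forall n m, Cmod (f n m) <= K * r ^ n * s ^ m)%R ->
  (forall n, is_series (f n) (g n)) ->
  (forall m, is_series (fun n => f n m) (h m)) ->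
  exists l, is_series g l /\ is_series h l.
Proof.
  intros Hr Hs Hf Hg Hh.
  assert (Hhb : forall m, (Cmod (h m) <= K / (1 - r) * s ^ m)%R).
  { intros m; rewrite <- (is_CSeries_unique _ _ (Hh m)).
    replace (K / (1 - r) * s ^ m)%R with (K * s ^ m / (1 - r))%R by (field; lra).
    apply CSeries_geom_bound; [exact Hr|].
    intros n; eapply Rle_trans; [apply Hf|]; apply Req_le; ring. }
  destruct (CSeries_geom_bound h _ s Hs Hhb) as [Hl _].
  exists (CSeries h); split; [|exact Hl].
  (* The constant comes from summing the column-tail bounds K r^(N+1) s^m / (1 - r) over [m]. *)
  apply (is_Clim_seq_geom _ _ (K * r / (1 - r) / (1 - s)) r Hr); intros N.
  (* Finitely many rows may be added termwise, so a partial sum of [g] is itself a series over [m]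
     and can be compared with the sum of [h]. *)
  assert (Hfin : is_series (fun m => sum_n (fun n => f n m) N) (sum_n g N)).
  { induction N as [|N IH].
    - rewrite sum_O; eapply is_series_ext; [|apply (Hg 0%nat)].
      intros m; now rewrite sum_O.
    - rewrite sum_Sn; eapply is_series_ext; [|exact (is_series_plus _ _ _ _ IH (Hg (S N)))].
      intros m; now rewrite sum_Sn. }
  assert (Hd := is_series_minus_C _ _ _ _ Hfin Hl).
  eapply Rle_trans;
    [right; apply f_equal; symmetry; exact (is_CSeries_unique _ _ Hd)|].
  replace (K * r / (1 - r) / (1 - s) * r ^ N)%R
    with ((K * r ^ S N / (1 - r)) / (1 - s))%R by (simpl; field; lra).
  apply CSeries_geom_bound; [exact Hs|]; intros m.
  assert (Ht : is_series (fun k => f (S N + k)%nat m) (h m - sum_n (fun n => f n m) N)).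
  { apply (is_series_incr_n (fun n => f n m)); [lia|].
    simpl Init.Nat.pred.
    change (is_series (fun n => f n m) (h m - sum_n (fun n => f n m) N + sum_n (fun n => f n m) N)).
    replace (h m - _ + _) with (h m) by ring.
    apply Hh. }
  replace (Cmod _) with (Cmod (h m - sum_n (fun n => f n m) N))
    by (rewrite <- Cmod_opp; f_equal; ring).
  rewrite <- (is_CSeries_unique _ _ Ht).
  replace (K * r ^ S N / (1 - r) * s ^ m)%R with (K * r ^ S N * s ^ m / (1 - r))%R
    by (field; lra).
  apply CSeries_geom_bound; [exact Hr|]; intros k.
  eapply Rle_trans; [apply Hf|]; rewrite pow_add; apply Req_le; ring.
Qed.

(** * q-Pochhammer symbols *)

(** By 1 + x <= exp x each step costs at most r exp(Y s^n), and the exponents add up to at most Y /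
    (1 - s). This one estimate bounds (A;q)_n, its inverse and P_n(a). *)
Lemma geom_product_bound (p : nat -> C) (r Y s : R) :
  (0 <= r)%R -> (0 <= Y)%R -> (0 <= s < 1)%R -> (Cmod (p 0%nat) <= 1)%R ->
  (forall n, Cmod (p (S n)) <= Cmod (p n) * (r * (1 + Y * s ^ n)))%R ->
  forall n, (Cmod (p n) <= exp (Y / (1 - s)) * r ^ n)%R.
Proof.
  intros Hr HY Hs H0 HS.
  (* The induction needs the exact partial sum Y (1 + s + ... + s^(n-1)) in the exponent; the
     limiting value alone is not inductive. *)
  assert (Hstrong : forall n, (Cmod (p n) <= exp (Y * (1 - s ^ n) / (1 - s)) * r ^ n)%R).
  { induction n as [|n IH].
    - replace (Y * (1 - s ^ 0) / (1 - s))%R with 0%R by (simpl; field; lra).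
      rewrite exp_0; simpl; lra.
    - eapply Rle_trans; [apply HS|].
      replace (Y * (1 - s ^ S n) / (1 - s))%R
        with (Y * (1 - s ^ n) / (1 - s) + Y * s ^ n)%R by (simpl; field; lra).
      rewrite exp_plus.
      replace (exp (Y * (1 - s ^ n) / (1 - s)) * exp (Y * s ^ n) * r ^ S n)%R
        with (exp (Y * (1 - s ^ n) / (1 - s)) * r ^ n * (r * exp (Y * s ^ n)))%R
        by (simpl; ring).
      assert (Hsn : (0 <= s ^ n)%R) by (apply pow_le; lra).
      apply Rmult_le_compat; [apply Cmod_ge_0| |exact IH|].
      + apply Rmult_le_pos; [exact Hr|]; nra.
      + apply Rmult_le_compat_l; [exact Hr|apply exp_ineq1_le]. }
  intros n; eapply Rle_trans; [apply Hstrong|].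
  apply Rmult_le_compat_r; [now apply pow_le|].
  assert (Hle : (Y * (1 - s ^ n) / (1 - s) <= Y / (1 - s))%R).
  { apply Rmult_le_compat_r; [left; apply Rinv_0_lt_compat; lra|].
    assert (Hsn : (0 <= s ^ n)%R) by (apply pow_le; lra); nra. }
  destruct Hle as [Hlt|Heq]; [left; now apply exp_increasing|rewrite Heq; lra].
Qed.

Lemma qpoch_factor_neq_0 (A q : C) (n : nat) :
  (Cmod A < 1)%R -> (Cmod q < 1)%R -> 1 - A * q ^ n <> 0.
Proof.
  intros HA Hq; apply one_minus_neq_0, Cmod_mult_lt_1; [exact HA|].
  apply Cmod_pow_le_1; lra.
Qed.

Lemma qpoch_neq_0 (A q : C) (n : nat) :
  (Cmod A < 1)%R -> (Cmod q < 1)%R -> qpoch A q n <> 0.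
Proof.
  intros HA Hq; induction n as [|n IH]; simpl.
  - exact C1_nz.
  - now apply Cmult_neq_0; [|apply qpoch_factor_neq_0].
Qed.

Lemma qpoch_bound (A q : C) :
  (Cmod q < 1)%R -> exists K : R, forall n, (Cmod (qpoch A q n) <= K)%R.
Proof.
  intros Hq; assert (Hq0 := Cmod_ge_0 q).
  exists (exp (Cmod A / (1 - Cmod q))); intros n.
  eapply Rle_trans;
    [apply (geom_product_bound (qpoch A q) 1 (Cmod A) (Cmod q))|rewrite pow1; lra];
    auto using Cmod_ge_0; try lra.
  - simpl; rewrite Cmod_1; lra.
  - clear n; intros n; simpl; rewrite Cmod_mult, Rmult_1_l, <- Cmod_pow, <- (Cmod_mult A).
    apply Rmult_le_compat_l; [apply Cmod_ge_0|].
    eapply Rle_trans; [apply Cmod_triangle|]; rewrite Cmod_1, Cmod_opp; lra.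
Qed.

(** Since 1 / (1 - |A| t) <= 1 + |A| t / (1 - |A|) for 0 <= t <= 1, the inverse factors have the
    shape required by [geom_product_bound], with Y = |A| / (1 - |A|). *)
Lemma qpoch_inv_bound (A q : C) :
  (Cmod A < 1)%R -> (Cmod q < 1)%R ->
  exists K : R, forall n, (Cmod (/ qpoch A q n) <= K)%R.
Proof.
  intros HA Hq; assert (Hq0 := Cmod_ge_0 q); assert (HA0 := Cmod_ge_0 A).
  assert (HY : (0 <= Cmod A / (1 - Cmod A))%R)
    by (apply Rmult_le_pos; [exact HA0|left; apply Rinv_0_lt_compat; lra]).
  exists (exp (Cmod A / (1 - Cmod A) / (1 - Cmod q))); intros n.
  eapply Rle_trans;
    [apply (geom_product_bound (fun n => / qpoch A q n) 1 (Cmod A / (1 - Cmod A)) (Cmod q))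
    |rewrite pow1; lra]; auto; try lra.
  - simpl; rewrite Cmod_inv by exact C1_nz; rewrite Cmod_1; lra.
  - clear n; intros n; simpl.
    assert (H1 := qpoch_neq_0 A q n HA Hq); assert (H2 := qpoch_factor_neq_0 A q n HA Hq).
    replace (/ (qpoch A q n * (1 - A * q ^ n)))
      with (/ qpoch A q n * / (1 - A * q ^ n)) by (field; now split).
    rewrite Cmod_mult, Rmult_1_l; apply Rmult_le_compat_l; [apply Cmod_ge_0|].
    assert (Ht : (0 <= Cmod q ^ n <= 1)%R) by (apply pow_le_1; lra).
    eapply Rle_trans.
    + apply (Cmod_inv_one_minus_le _ (Cmod A * Cmod q ^ n)).
      rewrite Cmod_mult, Cmod_pow; split; [lra|nra].
    + set (t := (Cmod q ^ n)%R) in *.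
      apply (Rmult_le_reg_l (1 - Cmod A * t)); [nra|].
      rewrite Rinv_r by nra.
      apply (Rmult_le_reg_l (1 - Cmod A)); [lra|].
      replace ((1 - Cmod A) * ((1 - Cmod A * t) * (1 + Cmod A / (1 - Cmod A) * t)))%R
        with ((1 - Cmod A * t) * (1 - Cmod A + Cmod A * t))%R by (field; lra).
      (* This product is exactly the excess of (1 - |A| t)(1 - |A| + |A| t) over 1 - |A|. *)
      assert (0 <= Cmod A * t * (Cmod A * (1 - t)))%R
        by (apply Rmult_le_pos; apply Rmult_le_pos; lra).
      nra.
Qed.

(** The increments are -(A;q)_n A q^n, which are geometrically small because (A;q)_n is bounded. *)
Lemma qpoch_cv (A q : C) : (Cmod q < 1)%R -> ex_Clim_seq (qpoch A q).
Proof.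
  intros Hq; assert (Hq0 := Cmod_ge_0 q).
  destruct (qpoch_bound A q Hq) as [K HK].
  destruct (CSeries_geom_bound (fun n => qpoch A q n * (A * q ^ n))
              (K * Cmod A) (Cmod q)) as [H _]; [lra| |].
  { intros n; rewrite Rmult_assoc; apply Cmod_mult_le; [apply HK|].
    rewrite Cmod_mult, Cmod_pow; lra. }
  set (l := CSeries _) in H; exists (1 - l).
  (* Initial value followed by the increments, so that the partial sums of [v] are [qpoch A q]
     itself. *)
  set (v := fun n => match n with O => RtoC 1 | S k => qpoch A q (S k) - qpoch A q k end).
  assert (Hv : is_series v (1 - l)).
  { apply is_series_decr_1.
    change (is_series (fun k => v (S k)) (1 - l + - (1))).
    replace (1 - l + - (1)) with (- (1) * l) by ring.
    eapply is_series_ext_C; [|exact (is_series_scal_C _ (- (1)) _ H)].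
    intros n; simpl; ring. }
  refine (is_Clim_seq_ext _ _ _ _ Hv).
  induction n as [|n IH].
  - now rewrite sum_O.
  - rewrite sum_Sn, IH.
    change (qpoch A q n + (qpoch A q (S n) - qpoch A q n) = qpoch A q (S n)); ring.
Qed.

Lemma qpoch_div_pow_0 (b a q : C) : qpoch_div_pow b a q 0 = 1.
Proof. unfold qpoch_div_pow; destruct (Ceq_dec a 0); simpl; ring. Qed.

Lemma qpoch_div_pow_S (b a q : C) (n : nat) :
  qpoch_div_pow b a q (S n) = qpoch_div_pow b a q n * (a - b * q ^ n).
Proof.
  unfold qpoch_div_pow; destruct (Ceq_dec a 0) as [Ha|Ha].
  (* Adding 2n to the dividend adds exactly n to the quotient, so truncated division does no
     harm. *)
  - replace (S n * (S n - 1) / 2)%nat with (n * (n - 1) / 2 + n)%nat.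
    + rewrite Cpow_add_r, Cpow_S, Ha; ring.
    + rewrite <- Nat.div_add by lia; f_equal; destruct n; simpl; lia.
  - cbn [qpoch]; rewrite Cpow_S; field; exact Ha.
Qed.

(** From |a - b q^n| <= r (1 + (|b| / r) |q|^n). A separate positive [r] makes the division
    legitimate and covers a = 0 as well. *)
Lemma qpoch_div_pow_bound (b a q : C) (r : R) :
  (Cmod q < 1)%R -> (0 < r)%R -> (Cmod a <= r)%R ->
  exists K : R, forall n, (Cmod (qpoch_div_pow b a q n) <= K * r ^ n)%R.
Proof.
  intros Hq Hr Ha; assert (Hq0 := Cmod_ge_0 q).
  exists (exp (Cmod b / r / (1 - Cmod q))).
  apply geom_product_bound; try lra.
  - apply Rmult_le_pos; [apply Cmod_ge_0|left; now apply Rinv_0_lt_compat].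
  - rewrite qpoch_div_pow_0, Cmod_1; lra.
  - intros n; rewrite qpoch_div_pow_S, Cmod_mult.
    apply Rmult_le_compat_l; [apply Cmod_ge_0|].
    replace (r * (1 + Cmod b / r * Cmod q ^ n))%R with (r + Cmod b * Cmod q ^ n)%R
      by (field; lra).
    rewrite <- Cmod_pow, <- Cmod_mult.
    eapply Rle_trans; [apply Cmod_triangle|]; rewrite Cmod_opp; lra.
Qed.

(** * The first identity *)

Lemma Cmod_mult_pow_S_le (c q : C) (k : nat) :
  (Cmod c <= 1)%R -> (Cmod q < 1)%R -> (Cmod (c * q ^ S k) <= Cmod q)%R.
Proof.
  intros Hc Hq; rewrite Cpow_S.
  assert (Hq0 := Cmod_ge_0 q); assert (Hk := Cmod_pow_le_1 q k (Rlt_le _ _ Hq)).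
  replace (Cmod q) with (1 * (Cmod q * 1))%R by ring.
  now repeat apply Cmod_mult_le; try apply Rle_refl.
Qed.

Lemma one_minus_mult_pow_S_neq_0 (c q : C) (k : nat) :
  (Cmod c <= 1)%R -> (Cmod q < 1)%R -> 1 - c * q ^ S k <> 0.
Proof.
  intros Hc Hq; apply one_minus_neq_0.
  assert (H := Cmod_mult_pow_S_le c q k Hc Hq); lra.
Qed.

(* At [N = 0] this is the left-hand summand with [n = k + 1]. *)
Definition shifted_term (q a b c : C) (N k : nat) : C :=
  qpoch_div_pow b a q (S k) * (q ^ N) ^ S k
    / ((1 - c * q ^ S k) * qpoch b q (S k + N)).

(** Decay in [k] makes every E_N converge; decay in [N] makes P_N(c) E_N tend to 0. *)
Lemma shifted_term_bound (q a b c : C) :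
  (Cmod q < 1)%R -> (Cmod a < 1)%R -> (Cmod b < 1)%R -> (Cmod c <= 1)%R ->
  exists K r : R, (0 <= r < 1)%R /\
    forall N k, (Cmod (shifted_term q a b c N k) <= K * Cmod q ^ N * r ^ k)%R.
Proof.
  intros Hq Ha Hb Hc; assert (Hq0 := Cmod_ge_0 q); assert (Ha0 := Cmod_ge_0 a).
  (* The midpoint of |a| and 1 is still below 1, and positive even when a = 0. *)
  set (r := ((1 + Cmod a) / 2)%R); assert (Hr : (Cmod a <= r /\ 0 < r < 1)%R)
    by (unfold r; lra).
  destruct (qpoch_div_pow_bound b a q r) as [K1 HK1]; try tauto.
  destruct (qpoch_inv_bound b q Hb Hq) as [K2 HK2].
  exists (K1 * r * / (1 - Cmod q) * K2)%R, r; split; [lra|]; intros N k.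
  assert (H1 := one_minus_mult_pow_S_neq_0 c q k Hc Hq).
  assert (H2 := qpoch_neq_0 b q (S k + N) Hb Hq).
  (* One factor q^N of (q^N)^(k+1) is set aside to supply the decay in [N]; the other k factors are
     bounded by 1. *)
  replace (shifted_term q a b c N k) with
    (qpoch_div_pow b a q (S k) * (q ^ N * (q ^ N) ^ k)
      * / (1 - c * q ^ S k) * / qpoch b q (S k + N))
    by (unfold shifted_term; rewrite (Cpow_S (q ^ N)); field; now split).
  replace (K1 * r * / (1 - Cmod q) * K2 * Cmod q ^ N * r ^ k)%R
    with (K1 * r ^ S k * (Cmod q ^ N * 1) * / (1 - Cmod q) * K2)%R
    by (simpl; ring).
  repeat apply Cmod_mult_le; auto.
  - rewrite Cmod_pow; lra.
  - now apply Cmod_pow_le_1, Cmod_pow_le_1, Rlt_le.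
  - apply Cmod_inv_one_minus_le; split; [now apply Cmod_mult_pow_S_le|lra].
Qed.

(* The coefficient of [shifted_term] is chosen so that the factor [1 - c q^n] cancels;
   what remains is a telescoping sum. *)
Lemma shifted_term_step (q a b c : C) (N : nat) :
  (Cmod q < 1)%R -> (Cmod a < 1)%R -> (Cmod b < 1)%R -> (Cmod c <= 1)%R ->
  is_series (fun k => shifted_term q a b c N k
                      - (c - b * q ^ N) * shifted_term q a b c (S N) k)
    ((a - b) * q ^ N / (qpoch b q (S N) * (1 - a * q ^ N))).
Proof.
  intros Hq Ha Hb Hc; assert (Hq0 := Cmod_ge_0 q); assert (Ha0 := Cmod_ge_0 a).
  assert (HaN := qpoch_factor_neq_0 a q N Ha Hq).
  assert (HD : forall n, qpoch b q n <> 0) by (intros; now apply qpoch_neq_0).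
  set (u := fun k => qpoch_div_pow b a q (S k) * (q ^ N) ^ S k
                     / (qpoch b q (S k + N) * (1 - a * q ^ N))).
  assert (Hu : is_Clim_seq u 0).
  { set (r := ((1 + Cmod a) / 2)%R); assert (Hr : (Cmod a <= r /\ 0 < r < 1)%R)
      by (unfold r; lra).
    destruct (qpoch_div_pow_bound b a q r) as [K1 HK1]; try tauto.
    destruct (qpoch_inv_bound b q Hb Hq) as [K2 HK2].
    apply (is_Clim_seq_geom _ _ (K1 * r * K2 * Cmod (/ (1 - a * q ^ N))) r); [lra|].
    intros k.
    replace (u k - 0) with (qpoch_div_pow b a q (S k) * (q ^ N) ^ S k
        * / qpoch b q (S k + N) * / (1 - a * q ^ N)) by (unfold u; field; now split).
    replace (K1 * r * K2 * Cmod (/ (1 - a * q ^ N)) * r ^ k)%R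
      with (K1 * r ^ S k * 1 * K2 * Cmod (/ (1 - a * q ^ N)))%R by (simpl; ring).
    repeat apply Cmod_mult_le; auto; try apply Rle_refl.
    now apply Cmod_pow_le_1, Cmod_pow_le_1, Rlt_le. }
  replace (_ / _) with (u 0%nat - 0).
  2: { unfold u; rewrite qpoch_div_pow_S, qpoch_div_pow_0; simpl (1 + N)%nat.
       simpl (_ ^ _); field; split; auto. }
  refine (is_series_ext_C _ _ _ _ (is_series_telescope u 0 Hu)).
  intros k; unfold u, shifted_term.
  assert (Hck := one_minus_mult_pow_S_neq_0 c q k Hc Hq).
  assert (Hbk := qpoch_factor_neq_0 b q (S k + N) Hb Hq).
  rewrite (qpoch_div_pow_S _ _ _ (S k)).
  replace (S k + S N)%nat with (S (S k + N)) by lia.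
  change (S (S k) + N)%nat with (S (S k + N)).
  change (qpoch b q (S (S k + N)))
    with (qpoch b q (S k + N) * (1 - b * q ^ (S k + N))).
  rewrite (Cpow_S q N), (Cpow_mult_l q (q ^ N)), (Cpow_S (q ^ N) (S k)).
  assert (HDk := HD (S k + N)%nat).
  rewrite (Cpow_add_r q (S k) N) in *.
  set (D := qpoch b q (S k + N)) in *; set (P := qpoch_div_pow b a q (S k)).
  set (X := (q ^ N) ^ S k); set (y := q ^ S k) in *; set (z := q ^ N) in *.
  (* Both sides equal P X / (D (1 - b y z)): on the left (1 - b y z) - (c - b z) y = 1 - c y, on the
     right (1 - b y z) - (a - b y) z = 1 - a z. *)
  field; repeat split; auto.
Qed.

Definition lambert_diff (q a b : C) (m : nat) : C :=
  a * q ^ m / (1 - a * q ^ m) - b * q ^ m / (1 - b * q ^ m).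

Lemma is_series_lambert_side (q a b c : C) :
  (Cmod q < 1)%R -> (Cmod a < 1)%R -> (Cmod b < 1)%R -> (Cmod c <= 1)%R ->
  exists l : C, is_series (shifted_term q a b c 0) l /\
    is_series (fun m => qpoch_div_pow b c q m / qpoch b q m * lambert_diff q a b m) l.
Proof.
  intros Hq Ha Hb Hc; assert (Hq0 := Cmod_ge_0 q).
  destruct (shifted_term_bound q a b c Hq Ha Hb Hc) as (K & r & Hr & HK).
  assert (HE := fun N => CSeries_geom_bound _ _ r Hr (HK N)).
  set (E := fun N => CSeries (shifted_term q a b c N)) in HE.
  exists (E 0%nat); split; [apply HE|].
  set (u := fun N => qpoch_div_pow b c q N * E N).
  assert (Hu : is_Clim_seq u 0).
  (* As |c| <= 1, the rate 1 is admissible and P_N(c) stays bounded, while E_N is of order |q|^N. *)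
  { destruct (qpoch_div_pow_bound b c q 1) as [K1 HK1]; try lra.
    apply (is_Clim_seq_geom _ _ (K1 * (K / (1 - r))) (Cmod q)); [lra|]; intros N.
    replace (u N - 0) with (u N) by ring.
    replace (K1 * (K / (1 - r)) * Cmod q ^ N)%R
      with (K1 * 1 ^ N * (K * Cmod q ^ N / (1 - r)))%R by (rewrite pow1; field; lra).
    apply Cmod_mult_le; [apply HK1|apply HE]. }
  replace (E 0%nat) with (u 0%nat - 0) by (unfold u; rewrite qpoch_div_pow_0; ring).
  refine (is_series_ext_C _ _ _ _ (is_series_telescope u 0 Hu)).
  intros N; unfold u, lambert_diff; rewrite qpoch_div_pow_S.
  (* The same series summed in two ways: by telescoping, and by linearity as E_N - (c - b q^N)
     E_(N+1). *)
  assert (Hstep := is_series_unique_C _ _ _ (shifted_term_step q a b c N Hq Ha Hb Hc)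
    (is_series_minus_C _ _ _ _ (proj1 (HE N))
       (is_series_scal_C _ (c - b * q ^ N) _ (proj1 (HE (S N)))))).
  assert (HaN := qpoch_factor_neq_0 a q N Ha Hq).
  assert (HbN := qpoch_factor_neq_0 b q N Hb Hq).
  assert (HD := qpoch_neq_0 b q N Hb Hq).
  transitivity (qpoch_div_pow b c q N * (E N - (c - b * q ^ N) * E (S N))); [ring|].
  fold (E N) (E (S N)) in Hstep; rewrite <- Hstep; cbn [qpoch].
  (* With x = q^N this is (a - b) x / ((1 - a x)(1 - b x)) = a x / (1 - a x) - b x / (1 - b x). *)
  field; repeat split; auto.
Qed.

(** Follows from |1 - x q^m| >= 1 - |x|. It supplies the decay in [m] of the double series in the
    second identity, where [c] may have modulus 1. *)
Lemma lambert_diff_bound (q a b : C) :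
  (Cmod q < 1)%R -> (Cmod a < 1)%R -> (Cmod b < 1)%R ->
  exists K : R, forall m, (Cmod (lambert_diff q a b m) <= K * Cmod q ^ m)%R.
Proof.
  intros Hq Ha Hb; assert (Hq0 := Cmod_ge_0 q).
  assert (H : forall x m, (Cmod x < 1)%R ->
    (Cmod (x * q ^ m / (1 - x * q ^ m)) <= Cmod q ^ m * / (1 - Cmod x))%R).
  { intros x m Hx; assert (Hm := Cmod_pow_le_1 q m (Rlt_le _ _ Hq)).
    assert (Hx0 := Cmod_ge_0 x); assert (Hm0 := Cmod_ge_0 (q ^ m)).
    apply Cmod_mult_le.
    - rewrite Cmod_mult, <- Cmod_pow; nra.
    - apply Cmod_inv_one_minus_le; rewrite Cmod_mult; split; [nra|exact Hx]. }
  exists (/ (1 - Cmod a) + / (1 - Cmod b))%R; intros m.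
  eapply Rle_trans; [apply Cmod_triangle|]; rewrite Cmod_opp.
  assert (Hma := H a m Ha); assert (Hmb := H b m Hb); lra.
Qed.

(** * The q-binomial theorem *)

(** Coefficients of the basic hypergeometric series 1phi0(c; -; q, z), the series of the q-binomial
    theorem. *)
Definition phi10_coeff (c q : C) (n : nat) : C := qpoch c q n / qpoch q q n.

Definition phi10 (c q z : C) : C := CSeries (fun n => phi10_coeff c q n * z ^ n).

Lemma phi10_coeff_bound (c q : C) :
  (Cmod q < 1)%R -> exists K : R, forall n, (Cmod (phi10_coeff c q n) <= K)%R.
Proof.
  intros Hq; destruct (qpoch_bound c q Hq) as [K1 HK1].
  destruct (qpoch_inv_bound q q Hq Hq) as [K2 HK2].
  exists (K1 * K2)%R; intros n; now apply Cmod_mult_le.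
Qed.

Lemma is_series_phi10 (c q z : C) :
  (Cmod q < 1)%R -> (Cmod z < 1)%R ->
  is_series (fun n => phi10_coeff c q n * z ^ n) (phi10 c q z).
Proof.
  intros Hq Hz; destruct (phi10_coeff_bound c q Hq) as [K HK].
  apply (CSeries_geom_bound _ K (Cmod z)); [split; [apply Cmod_ge_0|exact Hz]|].
  intros n; apply Cmod_mult_le; [apply HK|]; rewrite Cmod_pow; lra.
Qed.

(* Compare coefficients of [z^(n+1)], using [A_(n+1) (1 - q^(n+1)) = A_n (1 - c q^n)]. *)
Lemma phi10_step (c q z : C) :
  (Cmod q < 1)%R -> (Cmod z < 1)%R ->
  (1 - z) * phi10 c q z = (1 - c * z) * phi10 c q (z * q).
Proof.
  intros Hq Hz.
  assert (Hzq : (Cmod (z * q) < 1)%R) by (apply Cmod_mult_lt_1; lra).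
  set (A := phi10_coeff c q).
  assert (H1 := is_series_phi10 c q z Hq Hz); assert (H2 := is_series_phi10 c q (z * q) Hq Hzq).
  fold A in H1, H2.
  assert (Hl : is_series (fun n => A n * (1 - q ^ n) * z ^ n)
                 (phi10 c q z - phi10 c q (z * q))).
  { refine (is_series_ext_C _ _ _ _ (is_series_minus_C _ _ _ _ H1 H2)).
    intros n; rewrite Cpow_mult_l; ring. }
  assert (Hr : is_series (fun n => z * (A n * (1 - c * q ^ n) * z ^ n))
                 (z * (phi10 c q z - c * phi10 c q (z * q)))).
  { apply is_series_scal_C.
    refine (is_series_ext_C _ _ _ _
      (is_series_minus_C _ _ _ _ H1 (is_series_scal_C _ c _ H2))).
    intros n; cbv beta; rewrite Cpow_mult_l; ring. }
  assert (Hl' : is_series (fun n => z * (A n * (1 - c * q ^ n) * z ^ n))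
                  (phi10 c q z - phi10 c q (z * q))).
  { refine (is_series_ext_C (fun n => A (S n) * (1 - q ^ S n) * z ^ S n) _ _ _ _).
    - intros n; unfold A, phi10_coeff; cbn [qpoch].
      assert (Hn := qpoch_neq_0 q q n Hq Hq).
      assert (Hf := qpoch_factor_neq_0 q q n Hq Hq).
      rewrite !Cpow_S; field; now split.
    (* The term n = 0 carries the factor 1 - q^0 = 0, so the index shift leaves the sum
       unchanged. *)
    - apply (is_series_incr_1 (fun n => A n * (1 - q ^ n) * z ^ n)).
      change (is_series (fun n => A n * (1 - q ^ n) * z ^ n)
                (phi10 c q z - phi10 c q (z * q) + A 0%nat * (1 - 1) * 1)).
      replace (_ + _) with (phi10 c q z - phi10 c q (z * q)) by ring.
      exact Hl. }
  assert (He := is_series_unique_C _ _ _ Hl' Hr).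
  transitivity (phi10 c q z - phi10 c q (z * q) - z * phi10 c q z + phi10 c q (z * q));
    [ring|rewrite He; ring].
Qed.

(** Iteration of [phi10_step]. It serves twice: N -> infinity gives the q-binomial theorem, and
    finite [N] evaluates [phi10] at z q^m in the second identity. *)
Lemma phi10_iter (c q z : C) (N : nat) :
  (Cmod q < 1)%R -> (Cmod z < 1)%R ->
  qpoch z q N * phi10 c q z = qpoch (c * z) q N * phi10 c q (z * q ^ N).
Proof.
  intros Hq Hz; induction N as [|N IH].
  - simpl; replace (z * 1) with z by ring; reflexivity.
  - assert (HzN : (Cmod (z * q ^ N) < 1)%R)
      by (apply Cmod_mult_lt_1; [exact Hz|apply Cmod_pow_le_1; lra]).
    assert (Hs := phi10_step c q _ Hq HzN); cbn [qpoch].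
    replace (z * q ^ S N) with (z * q ^ N * q) by (rewrite Cpow_S; ring).
    transitivity ((1 - z * q ^ N) * (qpoch z q N * phi10 c q z)); [ring|].
    rewrite IH.
    transitivity (qpoch (c * z) q N * ((1 - z * q ^ N) * phi10 c q (z * q ^ N))); [ring|].
    rewrite Hs; ring.
Qed.

Lemma phi10_near_0 (c q z : C) :
  (Cmod q < 1)%R -> (Cmod z < 1)%R ->
  exists K : R, forall N, (Cmod (phi10 c q (z * q ^ N) - 1) <= K * Cmod q ^ N)%R.
Proof.
  intros Hq Hz; assert (Hq0 := Cmod_ge_0 q); assert (Hz0 := Cmod_ge_0 z).
  destruct (phi10_coeff_bound c q Hq) as [K HK].
  exists (K / (1 - Cmod z))%R; intros N.
  assert (HzN : (Cmod (z * q ^ N) < 1)%R)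
    by (apply Cmod_mult_lt_1; [exact Hz|apply Cmod_pow_le_1; lra]).
  assert (HqN := pow_le_1 (Cmod q) N ltac:(lra)).
  assert (Hs : is_series (fun n => phi10_coeff c q (S n) * (z * q ^ N) ^ S n)
                 (phi10 c q (z * q ^ N) - 1)).
  { apply (is_series_incr_1 (fun n => phi10_coeff c q n * (z * q ^ N) ^ n)).
    change (is_series (fun n => phi10_coeff c q n * (z * q ^ N) ^ n)
              (phi10 c q (z * q ^ N) - 1 + 1 / 1 * 1)).
    replace (_ + _) with (phi10 c q (z * q ^ N)) by field.
    now apply is_series_phi10. }
  rewrite <- (is_CSeries_unique _ _ Hs).
  replace (K / (1 - Cmod z) * Cmod q ^ N)%R with (K * Cmod q ^ N / (1 - Cmod z))%R
    by (field; lra).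
  apply CSeries_geom_bound; [lra|]; intros n.
  rewrite Rmult_assoc; apply Cmod_mult_le; [apply HK|].
  (* Of |z q^N|^(n+1) only |q|^N |z|^n is kept; the remaining factors are at most 1. *)
  rewrite Cpow_S, Cpow_mult_l, !Cmod_mult, !Cmod_pow.
  assert (Hn : (0 <= (Cmod q ^ N) ^ n <= 1)%R) by now apply pow_le_1.
  assert (Hzn : (0 <= Cmod z ^ n)%R) by now apply pow_le.
  set (x := (Cmod q ^ N)%R) in *; set (y := (x ^ n)%R) in *; set (w := (Cmod z ^ n)%R) in *.
  replace (Cmod z * x * (w * y))%R with (x * w * (Cmod z * y))%R by ring.
  rewrite <- (Rmult_1_r (x * w)) at 2.
  apply Rmult_le_compat_l; [apply Rmult_le_pos; lra|].
  replace 1%R with (1 * 1)%R by ring; apply Rmult_le_compat; lra.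
Qed.

(** Limit of [phi10_iter]: z q^N tends to 0, where [phi10] takes the value 1. *)
Lemma q_binomial (c q z : C) :
  (Cmod q < 1)%R -> (Cmod z < 1)%R ->
  qpoch_inf z q * phi10 c q z = qpoch_inf (c * z) q.
Proof.
  intros Hq Hz; assert (Hq0 := Cmod_ge_0 q).
  destruct (qpoch_cv z q Hq) as [lz Hlz]; destruct (qpoch_cv (c * z) q Hq) as [lc Hlc].
  unfold qpoch_inf; rewrite (is_Clim_seq_unique _ _ Hlz), (is_Clim_seq_unique _ _ Hlc).
  destruct (qpoch_bound (c * z) q Hq) as [K1 HK1].
  destruct (phi10_near_0 c q z Hq Hz) as [K2 HK2].
  assert (H0 : is_Clim_seq (fun N => phi10 c q z * qpoch z q N - qpoch (c * z) q N) 0).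
  { apply (is_Clim_seq_geom _ _ (K1 * K2) (Cmod q)); [lra|]; intros N.
    rewrite (Cmult_comm (phi10 c q z)), phi10_iter by assumption.
    replace (_ - 0) with (qpoch (c * z) q N * (phi10 c q (z * q ^ N) - 1)) by ring.
    rewrite Rmult_assoc; now apply Cmod_mult_le. }
  assert (H := is_Clim_seq_inj _ _ _ H0
    (is_Clim_seq_minus _ _ _ _ (is_Clim_seq_scal _ (phi10 c q z) _ Hlz) Hlc)).
  rewrite Cmult_comm.
  transitivity (phi10 c q z * lz - lc + lc); [ring|rewrite <- H; ring].
Qed.

(** The inverses of (A;q)_n are bounded by some K, so 1 <= K |(A;q)_n|; a zero limit would give 1 <=
    0. *)
Lemma qpoch_inf_neq_0 (A q : C) :
  (Cmod A < 1)%R -> (Cmod q < 1)%R -> qpoch_inf A q <> 0.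
Proof.
  intros HA Hq; destruct (qpoch_cv A q Hq) as [l Hl].
  unfold qpoch_inf; rewrite (is_Clim_seq_unique _ _ Hl); intros ->.
  destruct (qpoch_inv_bound A q HA Hq) as [K HK].
  assert (H := is_lim_seq_le (fun _ => 1%R) (fun n => K * Cmod (qpoch A q n))%R 1 (K * Cmod 0)%R).
  simpl in H; rewrite Cmod_0, Rmult_0_r in H.
  enough (1 <= 0)%R by lra; apply H.
  - intros n; assert (Hn := qpoch_neq_0 A q n HA Hq).
    replace 1%R with (Cmod (/ qpoch A q n) * Cmod (qpoch A q n))%R.
    + apply Rmult_le_compat_r; [apply Cmod_ge_0|apply HK].
    + rewrite <- Cmod_mult, <- Cmod_1; f_equal; field; exact Hn.
  - apply is_lim_seq_const.
  - replace (Finite 0) with (Rbar_mult K (Cmod 0)) by (rewrite Cmod_0; simpl; f_equal; ring).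
    now apply is_lim_seq_scal_l, Cmod_is_Clim_seq.
Qed.

(** * The second identity *)

Lemma is_series_pow_S (x : C) :
  (Cmod x < 1)%R -> is_series (fun k => x ^ S k) (x / (1 - x)).
Proof.
  intros Hx; exact (is_series_scal_C _ x _ (is_series_geom_C x Hx)).
Qed.

(* Expand [1 / (1 - c q^(k+1+n))] as a geometric series and sum over [k] first. *)
Lemma is_series_inner (q a b c : C) (n : nat) :
  (Cmod q < 1)%R -> (Cmod a < 1)%R -> (Cmod b < 1)%R -> (Cmod c <= 1)%R ->
  exists l : C,
    is_series (fun k => (a ^ S k - b ^ S k) / (1 - c * q ^ (S k + n))) l /\
    is_series (fun m => (c * q ^ n) ^ m * lambert_diff q a b m) l.
Proof.
  intros Hq Ha Hb Hc; assert (Hq0 := Cmod_ge_0 q).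
  set (r := Rmax (Cmod a) (Cmod b)).
  assert (Har : (Cmod a <= r)%R) by apply Rmax_l.
  assert (Hbr : (Cmod b <= r)%R) by apply Rmax_r.
  assert (Hr1 : (r < 1)%R) by now apply Rmax_lub_lt.
  assert (Ha0 := Cmod_ge_0 a); assert (Hb0 := Cmod_ge_0 b).
  assert (Hx : forall k, (Cmod (c * q ^ (S k + n)) <= Cmod q)%R)
    by (intros k; simpl (S k + n)%nat; now apply Cmod_mult_pow_S_le).
  (* The constant 2 counts the powers of [a] and of [b], each at most r^k; the decay in [m] comes
     from |c q^(k+1+n)| <= |q|. *)
  apply (is_series_swap (fun k m => (a ^ S k - b ^ S k) * (c * q ^ (S k + n)) ^ m)
           _ _ 2 r (Cmod q)); try lra.
  - intros k m; apply Cmod_mult_le.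
    + assert (H : forall x, (Cmod x <= r -> Cmod (x ^ S k) <= r ^ k)%R).
      { intros x Hxr; rewrite Cpow_S, <- (Rmult_1_l (r ^ k)).
        apply Cmod_mult_le; [lra|]; rewrite Cmod_pow.
        apply pow_incr; split; [apply Cmod_ge_0|exact Hxr]. }
      eapply Rle_trans; [apply Cmod_triangle|]; rewrite Cmod_opp.
      assert (H1 := H a Har); assert (H2 := H b Hbr); lra.
    + rewrite Cmod_pow; apply pow_incr; split; [apply Cmod_ge_0|apply Hx].
  - intros k; apply is_series_scal_C, is_series_geom_C.
    eapply Rle_lt_trans; [apply Hx|exact Hq].
  - intros m.
    assert (Hp : forall x, (Cmod x < 1 -> Cmod (x * q ^ m) < 1)%R)
      by (intros x H; apply Cmod_mult_lt_1; [exact H|apply Cmod_pow_le_1; lra]).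
    refine (is_series_ext_C _ _ _ _ (is_series_scal_C _ ((c * q ^ n) ^ m) _
      (is_series_minus_C _ _ _ _ (is_series_pow_S _ (Hp a Ha)) (is_series_pow_S _ (Hp b Hb))))).
    intros k; cbv beta.
    rewrite !Cpow_mult_l, Cpow_add_r, Cpow_mult_l, <- !Cpow_mult_r.
    rewrite (Nat.mul_comm m (S k)); ring.
Qed.

(** Convergence is asserted next to each identity because [CSeries] and [qpoch_inf] are total and
    meaningful only for convergent arguments. *)
Theorem theorem2p1 (q a b c : C)
  (hq : (Cmod q < 1)%R) (ha : (Cmod a < 1)%R) (hb : (Cmod b < 1)%R)
  (hc : (Cmod c <= 1)%R) :
  let lhs (k : nat) : C :=
    let n := S k in
    qpoch_div_pow b a q n / ((1 - c * q ^ n) * qpoch b q n) in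
  let rhs1 (m : nat) : C :=
    qpoch_div_pow b c q m / qpoch b q m
      * (a * q ^ m / (1 - a * q ^ m) - b * q ^ m / (1 - b * q ^ m)) in
  let inner (n k : nat) : C :=
    let m := S k in (a ^ m - b ^ m) / (1 - c * q ^ (m + n)) in
  let rhs2 (n : nat) : C :=
    qpoch c q n * (b / c) ^ n / qpoch q q n * CSeries (inner n) in
  (ex_series lhs /\ ex_series rhs1 /\ CSeries lhs = CSeries rhs1)
  /\
  ((Cmod b < Cmod c)%R ->
     ex_Clim_seq (qpoch (b / c) q) /\ ex_Clim_seq (qpoch b q) /\
     (forall n : nat, ex_series (inner n)) /\ ex_series rhs2 /\
     CSeries lhs = qpoch_inf (b / c) q / qpoch_inf b q * CSeries rhs2).
Proof.
  intros lhs rhs1 inner rhs2; assert (Hq0 := Cmod_ge_0 q).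
  destruct (is_series_lambert_side q a b c hq ha hb hc) as (l & Hl & Hr1).
  change (is_series rhs1 l) in Hr1.
  assert (Hlhs : is_series lhs l).
  { refine (is_series_ext_C _ _ _ _ Hl); intros k; unfold shifted_term, lhs.
    rewrite Nat.add_0_r; simpl (q ^ 0); rewrite Cpow_1_l, Cmult_1_r; reflexivity. }
  rewrite (is_CSeries_unique _ _ Hlhs), (is_CSeries_unique _ _ Hr1).
  split; [split; [now exists l|split; [now exists l|reflexivity]]|intros Hbc].
  assert (Hb0 := Cmod_ge_0 b).
  assert (Hc0 : c <> 0) by (apply Cmod_gt_0; lra).
  set (z := b / c) in *.
  assert (Hz : (Cmod z < 1)%R).
  { unfold z; rewrite Cmod_div by exact Hc0.
    apply (Rmult_lt_reg_r (Cmod c)); [lra|].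
    replace (Cmod b / Cmod c * Cmod c)%R with (Cmod b) by (field; lra); lra. }
  assert (Hcz : c * z = b) by (unfold z; field; exact Hc0).
  assert (Hinner := fun n => is_series_inner q a b c n hq ha hb hc).
  assert (Hrhs2 : exists l2, is_series rhs2 l2 /\
    is_series (fun m => c ^ m * lambert_diff q a b m * phi10 c q (z * q ^ m)) l2).
  { destruct (phi10_coeff_bound c q hq) as [K1 HK1].
    destruct (lambert_diff_bound q a b hq ha hb) as [K2 HK2].
    (* Rows sum to the terms of [rhs2] by [is_series_inner]; in column [m] the powers combine to (z
       q^m)^n and give [phi10] at z q^m. *)
    apply (is_series_swap (fun n m => phi10_coeff c q n * z ^ n
             * ((c * q ^ n) ^ m * lambert_diff q a b m)) _ _ (K1 * K2) (Cmod z) (Cmod q)).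
    - split; [apply Cmod_ge_0|exact Hz].
    - lra.
    - intros n m.
      replace (K1 * K2 * Cmod z ^ n * Cmod q ^ m)%R
        with (K1 * Cmod z ^ n * (1 * (K2 * Cmod q ^ m)))%R by ring.
      repeat apply Cmod_mult_le; auto.
      + rewrite Cmod_pow; lra.
      + apply Cmod_pow_le_1; replace 1%R with (1 * 1)%R by ring.
        apply Cmod_mult_le; [exact hc|apply Cmod_pow_le_1; lra].
    - intros n; destruct (Hinner n) as (i & Hi & Hi'); change (is_series (inner n) i) in Hi.
      unfold rhs2; rewrite (is_CSeries_unique _ _ Hi).
      replace (qpoch c q n * z ^ n / qpoch q q n) with (phi10_coeff c q n * z ^ n)
        by (unfold phi10_coeff, Cdiv; ring).
      now apply is_series_scal_C.
    - intros m.
      assert (Hzm : (Cmod (z * q ^ m) < 1)%R)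
        by (apply Cmod_mult_lt_1; [exact Hz|apply Cmod_pow_le_1; lra]).
      refine (is_series_ext_C _ _ _ _ (is_series_scal_C _ (c ^ m * lambert_diff q a b m) _
        (is_series_phi10 c q _ hq Hzm))).
      intros n; cbv beta; rewrite !Cpow_mult_l, <- !Cpow_mult_r, (Nat.mul_comm m n); ring. }
  destruct Hrhs2 as (l2 & Hrhs2 & Hl2).
  split; [now apply qpoch_cv|split; [now apply qpoch_cv|]].
  split; [intros n; destruct (Hinner n) as (i & Hi & _); now exists i|].
  split; [now exists l2|].
  rewrite (is_CSeries_unique _ _ Hrhs2).
  apply (is_series_unique_C rhs1); [exact Hr1|].
  refine (is_series_ext_C _ _ _ _
    (is_series_scal_C _ (qpoch_inf z q / qpoch_inf b q) _ Hl2)).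
  intros m; unfold rhs1; fold (lambert_diff q a b m).
  (* Since c z = b, [phi10] at z q^m is (z;q)_m / (b;q)_m times its value at [z], and the infinite
     products in front cancel that value. What is left is the [m]-th term of [rhs1]. *)
  assert (Hqb := q_binomial c q z hq Hz); rewrite Hcz in Hqb.
  assert (Hit := phi10_iter c q z m hq Hz); rewrite Hcz in Hit.
  assert (Hinf := qpoch_inf_neq_0 b q hb hq); assert (HD := qpoch_neq_0 b q m hb hq).
  assert (Hm : qpoch_div_pow b c q m = qpoch z q m * c ^ m)
    by (unfold qpoch_div_pow; destruct (Ceq_dec c 0); [contradiction|reflexivity]).
  assert (Hphi : phi10 c q (z * q ^ m) = qpoch z q m * phi10 c q z / qpoch b q m)
    by (rewrite Hit; field; exact HD).
  rewrite Hm, Hphi.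
  transitivity (c ^ m * lambert_diff q a b m * qpoch z q m / qpoch b q m
                * (qpoch_inf z q * phi10 c q z / qpoch_inf b q)); [field; now split|].
  rewrite Hqb; field; now split.
Qed.
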